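(* Let $A+zB$ be a $2\times 2$ upper triangular complex (resp. real) regular pencil $$A+zB=\begin{bmatrix} a_{11}+zb_{11} & a_{12}+zb_{12}\\ 0 & a_{22}+zb_{22}\end{bmatrix}.$$ Then there exist unitary $U,V\in\mathbb{C}^{2\times 2}$ (resp. orthogonal $U,V\in\mathbb{R}^{2\times 2}$) such that $$U^*(A+zB)V=\begin{bmatrix} c_{11}+zd_{11} & c_{12}+zd_{12}\\ 0 & c_{22}+zd_{22}\end{bmatrix}=:C+zD$$ and (a) $\dfrac{a_{22}}{b_{22}}=\dfrac{c_{11}}{d_{11}}$, that is, $a_{22}+zb_{22}$ and $c_{11}+zd_{11}$ have the same eigenvalue (which can be equal to $\infty$), and (b) $\dfrac{a_{11}}{b_{11}}=\dfrac{c_{22}}{d_{22}}$, that is, $a_{11}+zb_{11}$ and $c_{22}+zd_{22}$ have the same eigenvalue (which can be equal to $\infty$).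
   Context: A square pencil $A+zB$ is regular if $\det(A+zB)$ is not identically zero as a polynomial in $z$. The ratios are understood as elements of $\mathbb{C}\cup\{\infty\}$, with $a/0=\infty$ for $a\ne 0$; the eigenvalue of a nonzero scalar pencil $a+zb$ is its root in $\mathbb{C}\cup\{\infty\}$, which is $\infty$ when $b=0$. *)

(* Defs.v *)
From mathcomp Require Import all_boot all_order all_algebra.
From mathcomp Require Import reals complex.
Set Implicit Arguments.
Unset Strict Implicit.
Unset Printing Implicit Defensive.
Import GRing.Theory Num.Theory.
Local Open Scope ring_scope.

(* The indeterminate 'X of {poly F} plays the role of z in A + zB. *)
Definition pencil (F : fieldType) (n : nat) (A B : 'M[F]_n) : 'M[{poly F}]_n :=
  map_mx polyC A + 'X *: map_mx polyC B.

Definition regular (F : fieldType) (n : nat) (P : 'M[{poly F}]_n) : Prop :=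
  \det P != 0.

Definition scalar_pencil (F : fieldType) (a b : F) : {poly F} :=
  a%:P + b *: 'X.

Definition orthogonalmx (R : fieldType) (n : nat) (Q : 'M[R]_n) : Prop :=
  Q^T *m Q = 1%:M.

(* F with one point at infinity adjoined. *)
Inductive extended (F : Type) : Type := Pt (z : F) | Infty.
Arguments Infty {F}.

(* a / 0 is Infty. The value at (0, 0) is meaningless: same_eigenvalue below
   excludes this case for both pairs. *)
Definition ext_ratio (F : fieldType) (a b : F) : extended F :=
  if b == 0 then Infty else Pt (a / b).

Definition is_eigenvalue (F : fieldType) (a b : F) (w : extended F) : Prop :=
  match w with
  | Pt z => root (scalar_pencil a b) z
  | Infty => b = 0
  end.

(* A nonzero scalar pencil has exactly one eigenvalue, so having the same
   eigenvalue is having the same predicate is_eigenvalue. *)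
Definition same_eigenvalue (F : fieldType) (a b c d : F) : Prop :=
  [/\ scalar_pencil a b != 0, scalar_pencil c d != 0
    & forall w : extended F, is_eigenvalue a b w <-> is_eigenvalue c d w].

(* Main.v *)
Require Import Defs.
From mathcomp Require Import all_boot all_order all_algebra.
From mathcomp Require Import reals complex.
From mathcomp Require Import ring.
Set Implicit Arguments.
Unset Strict Implicit.
Unset Printing Implicit Defensive.
Import Order.TTheory GRing.Theory Num.Theory.
Local Open Scope ring_scope.
Local Open Scope sesquilinear_scope.

(** Write [p11, p12, p22] for the entries of the pencil [A + zB], and
    [(a, b)] for the coefficients of [p22]. The second row of [b A - a B] is
    zero, so some nonzero [x] satisfies [b A x = a B x]. Since [(a, b)] is not
    [(0, 0)], this says that [A x = a y] and [B x = b y] for a single vector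
    [y], that is, [(A + zB) x = p22 y]; regularity forces [y != 0]
    ([deflating_pair]). Complete [x] and [y], once normalized, to unitary
    matrices [V] and [U] having them as first columns ([unitary_completion]).
    The first column of [U^* (A + zB) V] is then a nonzero multiple of
    [p22 e_1]: the transformed pencil is upper triangular and begins with the
    eigenvalue of [p22]. Comparing determinants, [p11 p22] agrees up to a
    nonzero constant with [p22] times the new (2,2) entry, so that this entry
    is a nonzero multiple of [p11] ([pencil_swap]).

    The complex and the real case are the same argument for a field with an
    involution [sigma] (complex conjugation, resp. the identity) for which
    every nonzero vector of the plane can be normalized. *)

Section ScalarPencil.
Variable F : fieldType.
Implicit Types a b c d k : F.

Lemma coef_scalar_pencil a b :
  (scalar_pencil a b)`_0 = a /\ (scalar_pencil a b)`_1 = b.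
Proof.
by rewrite /scalar_pencil !coefD !coefC !coefZ !coefX /= mulr0 mulr1 addr0 add0r.
Qed.

Lemma scalar_pencil_inj a b c d :
  scalar_pencil a b = scalar_pencil c d -> a = c /\ b = d.
Proof.
move=> e; have := coef_scalar_pencil a b; rewrite e.
by have [-> ->] := coef_scalar_pencil c d; case.
Qed.

Lemma scalar_pencil0 : scalar_pencil 0 0 = 0 :> {poly F}.
Proof. by rewrite /scalar_pencil scale0r addr0. Qed.

Lemma scalar_pencilZ k a b :
  scalar_pencil (k * a) (k * b) = k *: scalar_pencil a b.
Proof. by rewrite /scalar_pencil scalerDr scalerA -!mul_polyC polyCM. Qed.

Lemma eigenvalue_scale k a b : k != 0 -> scalar_pencil a b != 0 ->
  ext_ratio a b = ext_ratio (k * a) (k * b) /\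
  same_eigenvalue a b (k * a) (k * b).
Proof.
move=> k0 ab0; split.
  rewrite /ext_ratio mulf_eq0 (negPf k0) /=; case: eqP => // _.
  by rewrite -mulf_div divff ?mul1r.
split=> //; first by rewrite scalar_pencilZ scaler_eq0 negb_or k0.
case=> [z|] /=; first by rewrite scalar_pencilZ rootZ.
split=> [-> | /eqP]; first by rewrite mulr0.
by rewrite mulf_eq0 (negPf k0) => /eqP.
Qed.

End ScalarPencil.

Section Pencil.
Variable F : fieldType.

Lemma pencilE n (A B : 'M[F]_n) i j :
  pencil A B i j = scalar_pencil (A i j) (B i j).
Proof. by rewrite !mxE /scalar_pencil -mul_polyC mulrC. Qed.

Lemma mul_pencil n (L A B K : 'M[F]_n) :
  map_mx polyC L *m pencil A B *m map_mx polyC K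
  = pencil (L *m A *m K) (L *m B *m K).
Proof.
by rewrite /pencil mulmxDr mulmxDl -scalemxAr -scalemxAl !map_mxM.
Qed.

Lemma det_triangular_2 (T : comNzRingType) (M : 'M[T]_2) :
  M 1 0 = 0 -> \det M = M 0 0 * M 1 1.
Proof.
move=> M10; rewrite -det_tr det_trig; last first.
  apply/is_trig_mxP=> -[[|[|//]] i2] [[|[|//]] j2] // _; rewrite mxE -[RHS]M10.
  by congr (M _ _); apply: val_inj.
by rewrite big_ord_recl big_ord1 !mxE; congr (_ * M _ _); apply: val_inj.
Qed.

(** [(a, b)] is an eigenvalue of [A + zB] in homogeneous coordinates, and [x]
    is an eigenvector; the vector [y] is found by dividing by whichever of [a]
    and [b] is nonzero. If [y] were zero, the pencil itself would kill [x]. *)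
Lemma deflating_pair n (A B : 'M[F]_n) (a b : F) :
  regular (pencil A B) -> scalar_pencil a b != 0 -> \det (b *: A - a *: B) = 0 ->
  exists x y : 'cV[F]_n,
    [/\ x != 0, y != 0, A *m x = a *: y & B *m x = b *: y].
Proof.
move=> reg ab0; rewrite -det_tr => /eqP /det0P [v v0 vM].
pose x := v^T; have x0 : x != 0 by rewrite trmx_eq0.
have /eqP : (b *: A - a *: B) *m x = 0.
  by apply: trmx_inj; rewrite trmx_mul trmxK vM trmx0.
rewrite mulmxBl -!scalemxAl subr_eq0 => /eqP bAaB.
have [y Ay By] : exists2 y, A *m x = a *: y & B *m x = b *: y.
  have [b0 | b0] := eqVneq b 0; last first.
    exists (b^-1 *: (B *m x)); last by rewrite scalerA divff ?scale1r.
    by rewrite scalerA mulrC -scalerA -bAaB scalerA mulVf ?scale1r.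
  have a0 : a != 0 by apply: contraNneq ab0 => ->; rewrite b0 scalar_pencil0.
  exists (a^-1 *: (A *m x)); first by rewrite scalerA divff ?scale1r.
  by rewrite scalerA mulrC -scalerA bAaB scalerA mulVf ?scale1r.
exists x, y; split=> //; apply: contra_neq x0 => y0.
have Px : pencil A B *m map_mx polyC x = 0.
  by rewrite /pencil mulmxDl -scalemxAl -!map_mxM Ay By y0 !scaler0 map_mx0 scaler0 addr0.
have : \adj (pencil A B) *m (pencil A B *m map_mx polyC x) = 0.
  by rewrite Px mulmx0.
rewrite mulmxA mul_adj_mx mul_scalar_mx => /matrixP xz.
apply/matrixP => i j; move: (xz i j); rewrite !mxE => /eqP.
by rewrite mulf_eq0 (negPf reg) polyC_eq0 => /eqP.
Qed.

End Pencil.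

Section Involution.
Variables (F : fieldType) (sigma : {rmorphism F -> F}).
Hypothesis sigmaK : involutive sigma.
Hypothesis normalizable : forall a b : F, (a != 0) || (b != 0) ->
  exists2 r, r != 0 & (r * a) * sigma (r * a) + (r * b) * sigma (r * b) = 1.

(** With [v] the normalization of [x], the second column is
    [(- sigma v_1, sigma v_0)], which is orthogonal to [v]. *)
Lemma unitary_completion (x : 'cV[F]_2) : x != 0 ->
  exists (U : 'M[F]_2) r,
    [/\ r != 0, map_mx sigma U^T *m U = 1%:M & col 0 U = r *: x].
Proof.
move=> x0; have /normalizable [r r0 nx] : (x 0 0 != 0) || (x 1 0 != 0).
  rewrite -negb_and; apply: contra x0 => /andP[/eqP x00 /eqP x10].
  apply/eqP/colP=> i; rewrite mxE; case: i => [[|[|//]] i2].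
    by rewrite -[RHS]x00; congr (x _ _); apply: val_inj.
  by rewrite -[RHS]x10; congr (x _ _); apply: val_inj.
pose v i := r * x i 0.
pose U := \matrix_(i < 2, j < 2)
  if j == 0 then v i else if i == 0 then - sigma (v 1) else sigma (v 0).
exists U, r; split=> //; last by apply/colP=> i; rewrite !mxE.
have two (i : 'I_2) : i = 0 \/ i = 1.
  by case: i => [[|[|//]] i2]; [left | right]; apply: val_inj.
apply/matrixP=> i j; rewrite !mxE big_ord_recl big_ord1 !mxE.
have -> : lift 0 0 = 1 :> 'I_2 by apply: val_inj.
by case: (two i) => ->; case: (two j) => -> /=;
  rewrite -?nx /= ?rmorphN ?sigmaK /v; ring.
Qed.

(** The first columns of [U] and [V] come from a deflating pair for the
    eigenvalue of the (2,2) entry; the determinant then fixes the other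
    diagonal entry. *)
Lemma pencil_swap (A B : 'M[F]_2) :
  pencil A B 1 0 = 0 -> regular (pencil A B) ->
  exists U V C D : 'M[F]_2,
    [/\ map_mx sigma U^T *m U = 1%:M, map_mx sigma V^T *m V = 1%:M,
        map_mx polyC (map_mx sigma U^T) *m pencil A B *m map_mx polyC V
        = pencil C D
      & pencil C D 1 0 = 0] /\
    (ext_ratio (A 1 1) (B 1 1) = ext_ratio (C 0 0) (D 0 0) /\
     same_eigenvalue (A 1 1) (B 1 1) (C 0 0) (D 0 0)) /\
    (ext_ratio (A 0 0) (B 0 0) = ext_ratio (C 1 1) (D 1 1) /\
     same_eigenvalue (A 0 0) (B 0 0) (C 1 1) (D 1 1)).
Proof.
move=> P10 reg; have detP := det_triangular_2 P10.
have := reg; rewrite /regular detP mulf_eq0 negb_or !pencilE => /andP[p11 p22].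
have [A10 B10] : A 1 0 = 0 /\ B 1 0 = 0.
  by apply: scalar_pencil_inj; rewrite -pencilE P10 scalar_pencil0.
have [|x [y [x0 y0 Ax Bx]]] := deflating_pair reg p22.
  by rewrite det_triangular_2 !mxE ?A10 ?B10; ring.
have [V [r [r0 VV Vx]]] := unitary_completion x0.
have [U [s [s0 UU Uy]]] := unitary_completion y0.
set W := map_mx sigma U^T in UU *.
pose C := W *m A *m V; pose D := W *m B *m V; pose k := r / s.
have k0 : k != 0 by rewrite mulf_neq0 // invr_eq0.
have Wy : W *m y = s^-1 *: col 0 1%:M.
  by rewrite -UU colE -mulmxA -colE Uy -scalemxAr scalerA mulVf ?scale1r.
have col0 M m : M *m x = m *: y -> col 0 (W *m M *m V) = (k * m) *: col 0 1%:M.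
  move=> Mx; rewrite colE -!mulmxA -colE Vx -!scalemxAr Mx -scalemxAr Wy.
  by rewrite !scalerA; congr (_ *: _); rewrite /k; ring.
have entry0 M m i : M *m x = m *: y -> (W *m M *m V) i 0 = k * m * (i == 0)%:R.
  by move=> /col0 /colP /(_ i); rewrite !mxE.
have C00 : C 0 0 = k * A 1 1 by rewrite /C (entry0 _ _ _ Ax) mulr1.
have D00 : D 0 0 = k * B 1 1 by rewrite /D (entry0 _ _ _ Bx) mulr1.
have Q10 : pencil C D 1 0 = 0.
  by rewrite pencilE /C /D (entry0 _ _ _ Ax) (entry0 _ _ _ Bx) !mulr0 scalar_pencil0.
pose u := \det W * \det V.
have u0 : u != 0.
  have [Wu _] := mulmx1_unit UU; have [_ Vu] := mulmx1_unit VV.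
  by rewrite mulf_neq0 // -unitfE -unitmxE.
(* Both sides are the determinant of the transformed pencil; cancelling the
   common nonzero factor leaves the new (2,2) entry as a multiple of p11. *)
have detQ : u *: (scalar_pencil (A 0 0) (B 0 0) * scalar_pencil (A 1 1) (B 1 1))
    = (k *: scalar_pencil (A 1 1) (B 1 1)) * scalar_pencil (C 1 1) (D 1 1).
  rewrite -scalar_pencilZ -C00 -D00 -!pencilE -detP -det_triangular_2 //.
  rewrite /C /D -mul_pencil !det_mulmx (det_map_mx _ W) (det_map_mx _ V) -mul_polyC.
  by rewrite polyCM mulrAC.
have [C11 D11] : C 1 1 = u / k * A 0 0 /\ D 1 1 = u / k * B 0 0.
  apply: scalar_pencil_inj; rewrite scalar_pencilZ; apply: (mulfI p22).
  apply: (scalerI k0); rewrite scalerAl -detQ -scalerAr scalerA mulrCA divff //.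
  by rewrite mulr1 mulrC.
exists U, V, C, D; split; first by split; rewrite ?mul_pencil.
rewrite C00 D00 C11 D11; split; apply: eigenvalue_scale => //.
by rewrite mulf_neq0 // invr_eq0.
Qed.

End Involution.

Lemma normalizable_complex (R : realType) (a b : R[i]) :
  (a != 0) || (b != 0) ->
  exists2 r, r != 0 & (r * a) * (r * a)^* + (r * b) * (r * b)^* = 1.
Proof.
move=> ab; pose n : R[i] := `|a| ^+ 2 + `|b| ^+ 2.
have n0 : 0 < n.
  by case/orP: ab => h; [apply: ltr_wpDr | apply: ltr_wpDl];
    rewrite ?exprn_ge0 ?exprn_gt0 ?normr_gt0.
have n'0 : (sqrtC n)^-1 != 0 by rewrite invr_eq0 sqrtC_eq0 gt_eqF.
exists (sqrtC n)^-1 => //.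
rewrite -!normCK !normrM !exprMn -mulrDr -/n.
rewrite ger0_norm ?invr_ge0 ?sqrtC_ge0 ?ltW // exprVn sqrtCK mulVf //.
by rewrite gt_eqF.
Qed.

Lemma normalizable_real (R : realType) (a b : R) :
  (a != 0) || (b != 0) ->
  exists2 r, r != 0 & (r * a) * (r * a) + (r * b) * (r * b) = 1.
Proof.
move=> ab; pose n := a ^+ 2 + b ^+ 2.
have n0 : 0 < n.
  by case/orP: ab => h; [apply: ltr_wpDr | apply: ltr_wpDl];
    rewrite ?sqr_ge0 // lt_def sqrf_eq0 h sqr_ge0.
exists (Num.sqrt n)^-1; first by rewrite invr_eq0 gt_eqF // sqrtr_gt0.
rewrite -!expr2 !exprMn -mulrDr -/n exprVn sqr_sqrtr ?ltW // mulVf //.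
by rewrite gt_eqF.
Qed.

Theorem theoremA1 (R : realType) :
  (forall A B : 'M[R[i]]_2,
     pencil A B 1 0 = 0 ->
     regular (pencil A B) ->
     exists U V C D : 'M[R[i]]_2,
       [/\ U \is unitarymx, V \is unitarymx,
           map_mx polyC (U ^t*) *m pencil A B *m map_mx polyC V = pencil C D
         & pencil C D 1 0 = 0] /\
       (ext_ratio (A 1 1) (B 1 1) = ext_ratio (C 0 0) (D 0 0) /\
        same_eigenvalue (A 1 1) (B 1 1) (C 0 0) (D 0 0)) /\
       (ext_ratio (A 0 0) (B 0 0) = ext_ratio (C 1 1) (D 1 1) /\
        same_eigenvalue (A 0 0) (B 0 0) (C 1 1) (D 1 1)))
  /\
  (forall A B : 'M[R]_2,
     pencil A B 1 0 = 0 ->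
     regular (pencil A B) ->
     exists U V C D : 'M[R]_2,
       [/\ orthogonalmx U, orthogonalmx V,
           map_mx polyC U^T *m pencil A B *m map_mx polyC V = pencil C D
         & pencil C D 1 0 = 0] /\
       (ext_ratio (A 1 1) (B 1 1) = ext_ratio (C 0 0) (D 0 0) /\
        same_eigenvalue (A 1 1) (B 1 1) (C 0 0) (D 0 0)) /\
       (ext_ratio (A 0 0) (B 0 0) = ext_ratio (C 1 1) (D 1 1) /\
        same_eigenvalue (A 0 0) (B 0 0) (C 1 1) (D 1 1))).
Proof.
split=> A B P10 reg.
  have [U [V [C [D [[UU VV e Q10] eig]]]]] :=
    @pencil_swap _ Num.conj conjCK (@normalizable_complex R) _ _ P10 reg.
  exists U, V, C, D; split=> //.
  by split=> //; apply/unitarymxP/mulmx1C.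
have [U [V [C [D [[UU VV e Q10] eig]]]]] :=
  @pencil_swap _ idfun (fun=> erefl) (@normalizable_real R) _ _ P10 reg.
rewrite !map_mx_id // in UU VV e.
by exists U, V, C, D.
Qed.
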